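(* Let $(X,M,* )$ be a fuzzy metric space, with induced topology $\tau_M$, and let $X'$ denote the set of all accumulation points of $(X,\tau_M)$. The following conditions are equivalent: (a) $(X,M,* )$ is Lebesgue, i.e. it has the Lebesgue property. (b) Every real-valued continuous function on $(X,\tau_M)$ is $\mathbb{R}$-uniformly continuous as a mapping from $(X,M,* )$ to $\mathbb{R}$. (c) Every bounded real-valued continuous function on $(X,\tau_M)$ is $\mathbb{R}$-uniformly continuous as a mapping from $(X,M,* )$ to $\mathbb{R}$. (d) Every closed and discrete subset of $(X,\tau_M)$ is fuzzy uniformly discrete in $(X,M,* )$. (e) The set $X'$ is compact (in $\tau_M$), and for every $r\in(0,1)$ and every $s>0$ the set $X\setminus B(X',r,s)$ is fuzzy uniformly discrete in $(X,M,* )$. (f) The set $X'$ is compact (in $\tau_M$), and for every $\delta_1\in(0,1)$ and every $t_1>0$ there exist $\delta_2\in(0,1)$ and $t_2>0$ such that for each $x\in X$ with $M(x,X',t_1)\le 1-\delta_1$ we have $\sup_{y\in X,\,y\ne x}M(x,y,t_2)\le 1-\delta_2$.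
   Context: A continuous $t$-norm is a binary operation $*$ on $[0,1]$ that is associative, commutative, continuous, satisfies $a*1=a$ for all $a\in[0,1]$, and satisfies $a*c\le b*d$ whenever $a\le b$ and $c\le d$ in $[0,1]$. A fuzzy metric space (in the sense of George and Veeramani) is a triple $(X,M,* )$ where $X$ is a nonempty set, $*$ is a continuous $t$-norm and $M:X\times X\times(0,\infty)\to[0,1]$ is a map such that for all $x,y,z\in X$ and $s,t>0$: (i) $M(x,y,t)>0$; (ii) $M(x,y,t)=1$ if and only if $x=y$; (iii) $M(x,y,t)=M(y,x,t)$; (iv) $M(x,y,t)*M(y,z,s)\le M(x,z,t+s)$; (v) $M(x,y,\cdot):(0,\infty)\to[0,1]$ is continuous. For $x\in X$, $r\in(0,1)$, $t>0$ put $B(x,r,t)=\{y\in X: M(x,y,t)>1-r\}$. The sets $B(x,r,t)$ form a base of a topology $\tau_M$ on $X$, called the topology induced by $(M,* )$. For $A\subset X$, $c\in X$, $r\in(0,1)$, $t>0$: $B(A,r,t)=\bigcup_{a\in A}B(a,r,t)$ and $M(c,A,t)=\sup_{a\in A}M(c,a,t)$. Suprema of values of $M$ are taken in $[0,1]$, so the supremum over the empty set is $0$. $(X,M,* )$ has the Lebesgue property (is Lebesgue) if for every open cover $\mathcal{G}$ of $(X,\tau_M)$ there exist $r\in(0,1)$ and $t>0$ such that $\{B(x,r,t):x\in X\}$ refines $\mathcal{G}$, i.e. every $B(x,r,t)$, $x\in X$, is contained in some member of $\mathcal{G}$. A mapping $f:X\to\mathbb{R}$ is $\mathbb{R}$-uniformly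 continuous if for every $\epsilon>0$ there exist $r\in(0,1)$ and $s>0$ such that for all $x,y\in X$, $M(x,y,s)>1-r$ implies $|f(x)-f(y)|<\epsilon$. A subset $A\subset X$ is fuzzy uniformly discrete in $(X,M,* )$ if there exist $r\in(0,1)$ and $s>0$ such that $M(x,y,s)<1-r$ for all $x,y\in A$ with $x\neq y$. A subset of $(X,\tau_M)$ is discrete if its subspace topology is the discrete topology. *)

(* Defs.v *)
From HB Require Import structures.
From mathcomp Require Import all_boot all_order all_algebra.
From mathcomp Require Import all_classical all_reals all_analysis.

Set Implicit Arguments.
Unset Strict Implicit.
Unset Printing Implicit Defensive.

Import Order.TTheory GRing.Theory Num.Theory.
Import numFieldNormedType.Exports.

Local Open Scope classical_set_scope.
Local Open Scope ring_scope.

(* A binary operation on [0, 1] is represented by a total function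
   R -> R -> R of which only the values on [0, 1] x [0, 1] matter. *)
Record continuous_tnorm (R : realType) (T : R -> R -> R) : Prop :=
  ContinuousTnorm {
  tnorm_itv : forall a b, a \in `[0, 1] -> b \in `[0, 1] ->
    T a b \in `[0, 1] ;
  tnormA : forall a b c, a \in `[0, 1] -> b \in `[0, 1] -> c \in `[0, 1] ->
    T a (T b c) = T (T a b) c ;
  tnormC : forall a b, a \in `[0, 1] -> b \in `[0, 1] -> T a b = T b a ;
  tnorm_continuous :
    {within `[0, 1] `*` `[0, 1], continuous (fun p : R * R => T p.1 p.2)} ;
  tnorm1 : forall a, a \in `[0, 1] -> T a 1 = a ;
  tnorm_le : forall a b c d,
    a \in `[0, 1] -> b \in `[0, 1] -> c \in `[0, 1] -> d \in `[0, 1] ->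
    a <= b -> c <= d -> T a c <= T b d }.

(* Only the values of [fuzzy_dist] at positive times matter. *)
Record fuzzyMetricSpace (R : realType) := FuzzyMetricSpace {
  fuzzy_carrier :> Type ;
  fuzzy_nonempty : inhabited fuzzy_carrier ;
  tnorm : R -> R -> R ;
  tnormP : continuous_tnorm tnorm ;
  fuzzy_dist : fuzzy_carrier -> fuzzy_carrier -> R -> R ;
  fuzzy_dist_itv : forall x y t, 0 < t -> fuzzy_dist x y t \in `[0, 1] ;
  fuzzy_dist_gt0 : forall x y t, 0 < t -> 0 < fuzzy_dist x y t ;
  fuzzy_dist_eq1 : forall x y t, 0 < t -> fuzzy_dist x y t = 1 <-> x = y ;
  fuzzy_distC : forall x y t, 0 < t -> fuzzy_dist x y t = fuzzy_dist y x t ;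
  fuzzy_dist_triangle : forall x y z s t, 0 < s -> 0 < t ->
    tnorm (fuzzy_dist x y t) (fuzzy_dist y z s) <= fuzzy_dist x z (t + s) ;
  fuzzy_dist_continuous : forall x y,
    {within `]0, +oo[, continuous (fuzzy_dist x y)} }.

Section FuzzyBalls.
Context {R : realType} {X : fuzzyMetricSpace R}.
Local Notation M := (@fuzzy_dist R X).

Definition fuzzy_ball (x : X) (r t : R) : set X := [set y | 1 - r < M x y t].

Definition fuzzy_balls : set (set X) :=
  [set B | exists x r t, [/\ 0 < r < 1, 0 < t & B = fuzzy_ball x r t]].

Lemma fuzzy_dist_le x y s t : 0 < s -> s <= t -> M x y s <= M x y t.
Proof.
move=> s0; rewrite le_eqVlt => /orP[/eqP->//|st].
have ts0 : 0 < t - s by rewrite subr_gt0.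
have := fuzzy_dist_triangle x y y ts0 s0.
have -> : M y y (t - s) = 1 by apply/fuzzy_dist_eq1.
by rewrite (tnorm1 (tnormP X)) ?fuzzy_dist_itv// subrKC.
Qed.

Lemma fuzzy_ball_center x r t : 0 < r -> 0 < t -> fuzzy_ball x r t x.
Proof.
move=> r0 t0; rewrite /fuzzy_ball/=.
have -> : M x x t = 1 by apply/fuzzy_dist_eq1.
by rewrite ltrBlDr ltrDl.
Qed.

Lemma fuzzy_ball_sub x r1 r2 t1 t2 : 0 < t1 -> r1 <= r2 -> t1 <= t2 ->
  fuzzy_ball x r1 t1 `<=` fuzzy_ball x r2 t2.
Proof.
move=> t10 r12 t12 y; rewrite /fuzzy_ball/= => xy.
apply: (lt_le_trans _ (fuzzy_dist_le x y t10 t12)).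
by apply: le_lt_trans xy; rewrite lerB.
Qed.

Lemma fuzzy_ball_ball x r t y : 0 < t -> fuzzy_ball x r t y ->
  exists r' t', [/\ 0 < r' < 1, 0 < t' &
    fuzzy_ball y r' t' `<=` fuzzy_ball x r t].
Proof.
move=> t0; rewrite {1}/fuzzy_ball/= => xyt.
have [u [u0 ut xyu]] : exists u, [/\ 0 < u, u < t & 1 - r < M x y u].
  have /subspace_continuousP /(_ t) := @fuzzy_dist_continuous R X x y.
  rewrite /= in_itv/= t0 => /(_ isT) /(_ _ (lt_nbhsr xyt)).
  rewrite /= nbhs_simpl/= withinE => -[V tV eqV].
  have : \forall u \near t^'-, [/\ 0 < u, u < t & 1 - r < M x y u].
    near=> u.
    have u0 : 0 < u by near: u; exact: nbhs_left_gt.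
    have Vu : V u by near: u; exact: cvg_at_left_filter cvg_id _ tV.
    have : (V `&` `]0, +oo[) u by split; rewrite //= in_itv/= u0.
    by rewrite -eqV => -[].
  by move=> /filter_ex.
have a01 := fuzzy_dist_itv x y u0; set a := M x y u in a01 xyu.
have o01 : (1 : R) \in `[0, 1] by rewrite in_itv/= ler01 lexx.
have [s [s0 s1 ras]] : exists s, [/\ 0 < s, s < 1 & 1 - r < tnorm X a s].
  have /subspace_continuousP /(_ (a, 1)) := tnorm_continuous (tnormP X).
  have xyu1 : 1 - r < tnorm X a 1 by rewrite (tnorm1 (tnormP X)).
  move=> /(_ (conj a01 o01)) /(_ _ (lt_nbhsr xyu1)).
  rewrite /= nbhs_simpl/= withinE => -[V aV eqV].
  have aV1 : \forall s \near (1 : R), V (a, s).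
    case: aV => -[A B] /= [aA oB] AB.
    by apply: filterS oB => s Bs; apply: AB; split => //; exact: nbhs_singleton.
  have : \forall s \near (1 : R)^'-, [/\ 0 < s, s < 1 & 1 - r < tnorm X a s].
    near=> s.
    have s0 : 0 < s by near: s; exact: nbhs_left_gt.
    have s1 : s < 1 by [].
    have Vs : V (a, s) by near: s; exact: cvg_at_left_filter cvg_id _ aV1.
    have : (V `&` (`[0, 1] `*` `[0, 1])) (a, s).
      by split=> //; split=> //=; rewrite in_itv/= !ltW.
    by rewrite -eqV => -[].
  by move=> /filter_ex.
have tu0 : 0 < t - u by rewrite subr_gt0.
exists (1 - s), (t - u); split; rewrite ?subr_gt0 ?s1 ?gtrBl//.
move=> z; rewrite /fuzzy_ball/= opprB subrKC => syz.
have := fuzzy_dist_triangle x y z tu0 u0; rewrite subrKC.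
apply: lt_le_trans; apply: (lt_le_trans ras).
have s01 : s \in `[0, 1] by rewrite in_itv/= !ltW.
by apply: (tnorm_le (tnormP X)) => //; [exact: fuzzy_dist_itv|exact: ltW].
Unshelve. all: by end_near. Qed.

Lemma fuzzy_balls_cover : \bigcup_(B in fuzzy_balls) B = setT.
Proof.
apply/seteqP; split => // x _.
exists (fuzzy_ball x 2^-1 1); last by apply: fuzzy_ball_center.
exists x, 2^-1, 1; split => //.
by rewrite invr_gt0 ltr0n/= invf_lt1// ltr1n.
Qed.

Lemma fuzzy_balls_join (A B : set X) x :
  fuzzy_balls A -> fuzzy_balls B -> A x -> B x ->
  exists C, [/\ fuzzy_balls C, C x & C `<=` A `&` B].
Proof.
move=> [a [r [t [/andP[r0 r1] t0 ->]]]] [b [s [u [/andP[s0 s1] u0 ->]]]].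
move=> /(fuzzy_ball_ball t0)[r' [t' [/andP[r'0 r'1] t'0 subA]]].
move=> /(fuzzy_ball_ball u0)[s' [u' [/andP[s'0 s'1] u'0 subB]]].
have m0 : 0 < Num.min r' s' by rewrite lt_min r'0.
have n0 : 0 < Num.min t' u' by rewrite lt_min t'0.
exists (fuzzy_ball x (Num.min r' s') (Num.min t' u')); split.
- by exists x, (Num.min r' s'), (Num.min t' u'); rewrite m0 gt_min r'1.
- exact: fuzzy_ball_center.
- move=> y xy; split; [apply: subA|apply: subB]; move: y xy;
  by apply: fuzzy_ball_sub => //; rewrite ge_min lexx ?orbT.
Qed.

End FuzzyBalls.

HB.instance Definition _ (R : realType) (X : fuzzyMetricSpace R) :=
  gen_eqMixin (fuzzy_carrier X).
HB.instance Definition _ (R : realType) (X : fuzzyMetricSpace R) :=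
  gen_choiceMixin (fuzzy_carrier X).
(* The induced topology: open sets are the unions of balls. *)
HB.instance Definition _ (R : realType) (X : fuzzyMetricSpace R) :=
  isBaseTopological.Build (fuzzy_carrier X)
    (@fuzzy_balls_cover R X) (@fuzzy_balls_join R X).

Section FuzzyNotions.
Context {R : realType} {X : fuzzyMetricSpace R}.
Local Notation M := (@fuzzy_dist R X).

Definition fuzzy_ball_set (A : set X) (r t : R) : set X :=
  \bigcup_(a in A) fuzzy_ball a r t.

(* [sup] of the empty set is 0, and for t > 0 every set of values of M at t is
   bounded by 1. *)
Definition fuzzy_dist_set (c : X) (A : set X) (t : R) : R :=
  sup [set M c a t | a in A].

Definition fuzzy_uniformly_discrete (A : set X) : Prop :=
  exists r s : R, [/\ 0 < r < 1, 0 < s &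
    forall x y, A x -> A y -> x <> y -> M x y s < 1 - r].

Definition R_uniformly_continuous (f : X -> R) : Prop :=
  forall eps : R, 0 < eps -> exists r s : R, [/\ 0 < r < 1, 0 < s &
    forall x y, 1 - r < M x y s -> `|f x - f y| < eps].

End FuzzyNotions.

Definition fuzzy_Lebesgue (R : realType) (X : fuzzyMetricSpace R) : Prop :=
  forall G : set (set X), G `<=` open -> \bigcup_(U in G) U = setT ->
  exists r t : R, [/\ 0 < r < 1, 0 < t &
    forall x, exists2 U, G U & fuzzy_ball x r t `<=` U].

(* In [subspace A] the points outside A are artificially isolated, hence the
   restriction to subsets of A. *)
Definition discrete_subset (T : topologicalType) (A : set T) : Prop :=
  forall B : set (subspace A), B `<=` A -> open B.

(* Main.v *)
Require Import Defs.
From mathcomp Require Import all_boot all_order all_algebra.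
From mathcomp Require Import all_classical all_reals all_analysis.

Import Order.TTheory GRing.Theory Num.Theory.
Import numFieldNormedType.Exports.

Local Open Scope classical_set_scope.
Local Open Scope ring_scope.

(** The balls [D x e] of radius [e] and time [e] decrease with [e] and behave as
the entourages of a metrizable uniformity: they are symmetric, they separate
points, and by continuity of the t-norm at [(1, 1)] two steps of a small size
[d] make one step of size [e] ([fuzzy_ball_trans]). A condition on balls that is
inherited by smaller balls holds for some [r] and [t] if and only if it holds
for [D] with all small enough [e], so everything is phrased with the filter of
right neighbourhoods of 0.

A set is closed and discrete exactly when it has no limit point
([closed_discrete_limit_pointP]), which turns (d) into [closed_discrete_UD].

(a) gives (b) by covering the line with small intervals and pulling them back,
and (b) contains (c). For (c) implies (d), a closed discrete set that is not
uniformly discrete contains closer and closer pairs of distinct points; since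
its points are isolated, the pairs can be chosen so that the first points [x_n]
and the second points [y_n] form two disjoint closed sets. A Urysohn function
separating these sets is bounded and continuous, but not uniformly continuous.

The main consequence of (d) is [close_pairs_cluster]: if [x_n <> y_n] get
arbitrarily close, then [x_n] has a cluster point, since otherwise the set of
all [x_n] and [y_n] would be closed and discrete, but not uniformly discrete.
Points [x_n] whose small balls lie in no member of an open cover provide such
pairs, which contradicts the cluster point; so (d) implies (a). A separated
sequence of accumulation points also provides such pairs; so [X'] is totally
bounded. Lebesgue numbers and total boundedness together make [X'] compact.
The rest of (e) is an instance of (d), because the complement of a neighbourhood
of [X'] has no limit points. (e) implies (f): the points close to a point far
from [X'] are themselves somewhat far from [X'].

For (f) implies (a), compactness provides a Lebesgue number of the cover at the
points of [X'], hence also at the points near [X'], while each of the other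
points is alone in its ball of some fixed size. *)

Section FuzzyEntourages.
Set Implicit Arguments.
Unset Strict Implicit.
Unset Printing Implicit Defensive.
Context {R : realType} {X : fuzzyMetricSpace R}.
Local Notation M := (@fuzzy_dist R X).
Local Notation D x e := (@fuzzy_ball R X x e e).
Implicit Types (x y z : X) (e d r t : R) (A : set X).

(** * Small balls as entourages *)

Lemma fuzzy_ball_sym x y r t : 0 < t ->
  fuzzy_ball x r t y -> fuzzy_ball y r t x.
Proof. by move=> t0; rewrite /fuzzy_ball/= fuzzy_distC. Qed.

Lemma near0_fuzzy_ball_sub r t : 0 < r -> 0 < t ->
  \forall e \near 0^'+, forall x, D x e `<=` fuzzy_ball x r t.
Proof.
move=> r0 t0; near=> e => x.
have e0 : 0 < e by near: e; exact: nbhs_right_gt.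
by apply: fuzzy_ball_sub => //; near: e; exact: nbhs_right_ltW.
Unshelve. all: by end_near. Qed.

(** Small sizes can be taken below 1, so that the balls [D x e] belong to the
base of the topology. *)
Lemma near0_ex (P : set R) : (\forall e \near 0^'+, P e) ->
  exists e, [/\ 0 < e, e < 1 & P e].
Proof.
move=> P0; apply: (@filter_ex _ 0^'+).
by near=> e; split => //; near: e.
Unshelve. all: by end_near. Qed.

Lemma nbhs_fuzzyP x (U : set X) :
  nbhs x U <-> \forall e \near 0^'+, D x e `<=` U.
Proof.
split=> [[B [[/= F FB <-] [C FC Cx]] BU]|].
  have [a [r [t [r01 t0 CE]]]] := FB _ FC.
  move: Cx; rewrite CE => /(fuzzy_ball_ball t0)[r' [t' [/andP[r'0 _] t'0 sub]]].
  apply: filterS (near0_fuzzy_ball_sub r'0 t'0) => e /(_ x) /subset_trans.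
  apply; apply: subset_trans sub _; apply: subset_trans BU.
  by rewrite -CE; exact: bigcup_sup.
move=> /near0_ex[e [e0 e1 eU]].
exists (D x e); split => //; last exact: fuzzy_ball_center.
exists [set D x e]; last by rewrite bigcup_set1.
by move=> _ ->; exists x, e, e; rewrite e0.
Qed.

Lemma nbhs_fuzzy_ball x e : 0 < e -> nbhs x (D x e).
Proof.
move=> e0; apply/nbhs_fuzzyP.
by apply: filterS (near0_fuzzy_ball_sub e0 e0) => d; exact.
Qed.

(** The triangle inequality of the uniformity. As [T 1 1 = 1], continuity gives
[1 - e < T (1 - d) (1 - d)] for small [d], and monotonicity of [T] extends this
bound to all larger arguments; times add up, whence the condition [2 d <= e]. *)
Lemma fuzzy_ball_trans e : 0 < e ->
  \forall d \near 0^'+, forall x y z, D x d y -> D y d z -> D x e z.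
Proof.
move=> e0.
have tP := tnormP X.
have o01 : (1 : R) \in `[0, 1] by rewrite in_itv/= ler01 lexx.
have tnorm11 : 1 - e < tnorm X 1 1 by rewrite (tnorm1 tP)// gtrBl.
have /subspace_continuousP /(_ (1, 1) (conj o01 o01)) := tnorm_continuous tP.
move=> /(_ _ (lt_nbhsr tnorm11)); rewrite /= nbhs_simpl/= withinE.
move=> -[V V11 VE].
have V1d : \forall d \near 0^'+, V (1 - d, 1 - d).
  have cv : (fun d => 1 - d) @ 0^'+ --> (1 : R).
    apply: cvg_at_right_filter; rewrite -[in X in _ --> X](subr0 1).
    by apply: cvgB; [exact: cvg_cst|exact: cvg_id].
  case: V11 => -[A B] [/= A1 B1] AB.
  by near=> d; apply: AB; split => /=; near: d; [exact: cv A1|exact: cv B1].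
near=> d => x y z; rewrite /fuzzy_ball/= => xy yz.
have d0 : 0 < d by near: d; exact: nbhs_right_gt.
have d1 : d < 1 by near: d; exact: nbhs_right_lt.
have d01 : 1 - d \in `[0, 1] by rewrite in_itv/= subr_ge0 (ltW d1) gerBl ltW.
have tdd : 1 - e < tnorm X (1 - d) (1 - d).
  have : (V `&` (`[0, 1] `*` `[0, 1])) (1 - d, 1 - d).
    by split => //; near: d.
  by rewrite -VE => -[].
apply: (lt_le_trans tdd).
have d2e : d + d <= e.
  rewrite -mulr2n -mulr_natr -ler_pdivlMr//; near: d; apply: nbhs_right_ltW.
  by rewrite divr_gt0.
apply: le_trans (fuzzy_dist_le x z (addr_gt0 d0 d0) d2e).
apply: le_trans (fuzzy_dist_triangle x y z d0 d0).
by apply: (tnorm_le tP) => //; rewrite ?fuzzy_dist_itv// ltW.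
Unshelve. all: by end_near. Qed.

Lemma not_near0 (P : set R) : ~ (\forall e \near 0^'+, P e) ->
  forall n : nat, exists e, [/\ 0 < e, e <= n.+1%:R^-1 & ~ P e].
Proof.
move=> nP n; apply: contra_notP nP => /forallNP nP.
near=> e; apply: contrapT => nPe; apply: (nP e); split => //.
by near: e; apply: nbhs_right_ltW; rewrite invr_gt0.
Unshelve. all: by end_near. Qed.

Lemma near0_invn (P : set R) : (\forall e \near 0^'+, P e) ->
  exists N : nat, forall n : nat, (N <= n)%N -> P n.+1%:R^-1.
Proof.
move=> [e /= e0 eP]; have [N _ NP] := near_infty_natSinv_lt (PosNum e0).
exists N => n /NP ne; apply: eP; rewrite ?invr_gt0//=.
by rewrite sub0r normrN ger0_norm.
Qed.

(** Small balls separate points, because [M z w 1 < 1] when [z <> w]; hence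
finitely many terms of a sequence never affect whether [z] is a limit point. *)
Lemma near0_finite (u : nat -> X) N z :
  \forall e \near 0^'+, forall n, (n < N)%N -> D z e (u n) -> u n = z.
Proof.
have sep w : \forall e \near 0^'+, D z e w -> w = z.
  have [->|wz] := eqVneq w z; first by near=> e.
  have zw1 : M z w 1 < 1.
    have := fuzzy_dist_itv z w ltr01; rewrite in_itv/= => /andP[_].
    rewrite le_eqVlt => /orP[/eqP/fuzzy_dist_eq1|//] => /(_ ltr01) zw.
    by rewrite zw eqxx in wz.
  near=> e; rewrite /fuzzy_ball/= => zwe; exfalso.
  suff : M z w 1 < M z w 1 by rewrite ltxx.
  have e0 : 0 < e by near: e; exact: nbhs_right_gt.
  apply: (@le_lt_trans _ _ (1 - e)).
    rewrite lerBrDr -lerBrDl; near: e; apply: nbhs_right_ltW.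
    by rewrite subr_gt0.
  apply: lt_le_trans zwe _; apply: fuzzy_dist_le => //.
  by near: e; exact: nbhs_right_ltW.
have : \forall e \near 0^'+, forall i : 'I_N, D z e (u i) -> u i = z.
  by apply: filter_forall => i.
by apply: filterS => e + n nN => /(_ (Ordinal nN)).
Unshelve. all: by end_near. Qed.

(** * Uniformly discrete sets and sets without limit points *)

(** Passing from the size [e] to the radius [e / 2] turns the bound
[M x y e <= 1 - e] into a strict one. *)
Lemma fuzzy_uniformly_discreteP A : fuzzy_uniformly_discrete A <->
  \forall e \near 0^'+, forall x y, A x -> A y -> D x e y -> x = y.
Proof.
split=> [[r [s [/andP[r0 r1] s0 UD]]]|UD].
  apply: filterS (near0_fuzzy_ball_sub r0 s0) => e sub x y Ax Ay /sub xy.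
  apply: contrapT => /(UD _ _ Ax Ay); apply/negP; rewrite -leNgt.
  exact: ltW.
move: UD => /near0_ex[e [e0 e1 UD]]; exists (e / 2), e; split => //.
  by rewrite divr_gt0//= (lt_trans _ e1)// ltr_pdivrMr// mulr_natr mulr2n ltrDl.
move=> x y Ax Ay xy; have : M x y e <= 1 - e.
  by rewrite leNgt; apply/negP => /(UD _ _ Ax Ay).
move=> /le_lt_trans; apply.
by rewrite ltrD2l ltrN2 ltr_pdivrMr// mulr_natr mulr2n ltrDl.
Qed.

Lemma near0_limit_pointN A z : ~ limit_point A z <->
  \forall e \near 0^'+, forall w, A w -> D z e w -> w = z.
Proof.
rewrite not_limit_pointE; split => [[U /nbhs_fuzzyP zU AU]|zA].
  by apply: filterS zU => e eU w Aw /eU Uw; exact: AU.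
exists [set w | A w -> w = z]; last by move=> w [Aw /(_ Aw)].
by apply/nbhs_fuzzyP; apply: filterS zA => e + w zw => /[swap] Aw /(_ w Aw zw).
Qed.

Lemma limit_point_eq0P A : limit_point A = set0 <-> forall z, ~ limit_point A z.
Proof.
by split=> [-> z []|AN]; last by apply/seteqP; split => // z /AN.
Qed.

Lemma limit_point_eq0S A B : A `<=` B -> limit_point B = set0 ->
  limit_point A = set0.
Proof.
move=> AB /limit_point_eq0P BN; apply/limit_point_eq0P => z Az; apply: (BN z).
by move=> U /Az[y [yz Ay Uy]]; exists y; split => //; exact: AB.
Qed.

Lemma limit_point_eq0_closed A : limit_point A = set0 -> closed A.
Proof.
move=> /limit_point_eq0P AN z clz; apply: contrapT => nAz; apply: (AN z).
move=> U /clz[y [Ay Uy]]; exists y; split => //.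
by apply/eqP => yz; apply: nAz; rewrite -yz.
Qed.

(** A limit point of a closed set lies in it and is not isolated in it.
Conversely all subsets of a set without limit points are closed. *)
Lemma closed_discrete_limit_pointP A :
  closed A /\ discrete_subset A <-> limit_point A = set0.
Proof.
split=> [[clA dA]|A0].
  apply/limit_point_eq0P => z Az.
  have Az' : A z by apply: clA; exact: subset_limit_point.
  have /open_subspaceP[V oV VA] : open ([set z] : set (subspace A)).
    by apply: dA => _ ->.
  have : (V `&` A) z by rewrite VA.
  move=> [Vz _]; have [y [/eqP yz Ay Vy]] := Az _ (open_nbhs_nbhs (conj oV Vz)).
  have : (V `&` A) y by [].
  by rewrite VA => -[].
split; first exact: limit_point_eq0_closed.
move=> B BA; apply/open_subspaceP; exists (~` (A `\` B)).
  apply: closed_openC; apply: limit_point_eq0_closed.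
  by apply: limit_point_eq0S A0 => x [].
apply/seteqP; split => x [h1 h2]; split => //.
  by apply: contrapT => nBx; apply: h1.
by case.
Qed.

(** Give each point of one closed set a size such that no two steps of that size
lead to the other closed set. If the balls of these sizes around a point of each
set met, then two steps of the larger size would lead from one centre to the
other. *)
Lemma fuzzy_normal : normal_space X.
Proof.
apply/(@normal_openP R) => A B clA clB AB0.
have /choice[dlt dltP] : forall e, exists d, 0 < e -> 0 < d /\
    forall x y z, D x d y -> D y d z -> D x e z.
  move=> e.
  have [e0|] := ltP 0 e; last by exists 0.
  by have [d [d0 _ dP]] := near0_ex (fuzzy_ball_trans e0); exists d.
have away (C : set X) : closed C ->
    exists f : X -> R, forall x, 0 < f x /\ (~ C x -> D x (f x) `<=` ~` C).
  move=> clC; suff /choice[f fP] : forall x, exists e, 0 < e /\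
    (~ C x -> D x e `<=` ~` C) by exists f.
  move=> x.
  have [Cx|nCx] := pselect (C x); first by exists 1.
  have /nbhs_fuzzyP Cnx : nbhs x (~` C).
    by apply: open_nbhs_nbhs; split => //; exact: closed_openC.
  by have [e [e0 _ eC]] := near0_ex Cnx; exists e.
have [f fP] := away _ clB; have [g gP] := away _ clA.
have nbd (S : set X) (h : X -> R) : (forall x, 0 < h x) ->
    S `<=` (\bigcup_(x in S) D x (dlt (h x)))°.
  move=> h0 x Sx; have := nbhs_fuzzy_ball x (proj1 (dltP _ (h0 x))).
  by apply: filterS => y xy; exists x.
exists (\bigcup_(x in A) D x (dlt (f x)))°,
  (\bigcup_(x in B) D x (dlt (g x)))°.
split; try exact: open_interior.
- by apply: nbd => x; case: (fP x).
- by apply: nbd => x; case: (gP x).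
apply/seteqP; split => // z [].
move=> /interior_subset[a Aa az] /interior_subset[b Bb bz].
have aB : ~ B a by move=> Ba; have : (A `&` B) a by []; rewrite AB0.
have bA : ~ A b by move=> Ab; have : (A `&` B) b by []; rewrite AB0.
have [fa0 /(_ aB)fa] := fP a; have [gb0 /(_ bA)gb] := gP b.
have [df0 dfP] := dltP _ fa0; have [dg0 dgP] := dltP _ gb0.
have [fg|gf] := leP (dlt (g b)) (dlt (f a)).
- apply: (fa b) => //; apply: dfP az _; apply: fuzzy_ball_sym => //.
  exact: fuzzy_ball_sub bz.
- apply: (gb a) => //; apply: dgP bz _; apply: fuzzy_ball_sym => //.
  by apply: fuzzy_ball_sub az; rewrite // ltW.
Qed.

(** * From closed discrete sets to Lebesgue numbers and compactness *)

(** Condition (d), with closed discrete sets described by their limit points. *)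
Definition closed_discrete_UD : Prop := forall A, limit_point A = set0 ->
  fuzzy_uniformly_discrete A.

(** If [x] has no cluster point, then neither does [y], and near each point the
set of all their values reduces to finitely many terms. It thus has no limit
point, but it contains arbitrarily close pairs of distinct points. *)
Lemma close_pairs_cluster (x y : nat -> X) : closed_discrete_UD ->
  (forall n, x n <> y n) -> (forall n, D (x n) n.+1%:R^-1 (y n)) ->
  exists z, forall e, 0 < e ->
    forall N : nat, exists2 n, (N <= n)%N & D z e (x n).
Proof.
move=> cdUD xy xyn; apply: contrapT => /forallNP nz.
have [|A0] := pselect (limit_point (range x `|` range y) = set0).
  move=> /cdUD /fuzzy_uniformly_discreteP /near0_invn[N /(_ N (leqnn N)) UD].
  apply: (xy N); apply: UD (xyn N); first by left; exists N.
  by right; exists N.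
apply: A0; apply/limit_point_eq0P => z; apply/near0_limit_pointN.
have /existsNP[e /not_implyP[e0 /existsNP[N zN]]] := nz z.
have {}zN n d : (N <= n)%N -> 0 < d -> d <= e -> ~ D z d (x n).
  by move=> Nn d0 de zx; apply: zN; exists n => //; exact: fuzzy_ball_sub zx.
have [d [d0 _ [de dP]]] :=
  near0_ex (filterI (nbhs_right_ltW e0) (fuzzy_ball_trans e0)).
have [N' N'P] := near0_invn (nbhs_right_ltW d0).
(* Beyond [maxn N N'], a value [y n] in the [d']-ball of [z] would put [x n] in
   the [e]-ball of [z]. *)
near=> d'; have d'0 : 0 < d' by [].
have d'd : d' <= d by near: d'; exact: nbhs_right_ltW.
move=> w [[n _ <-]|[n _ <-]].
- have [nN|Nn] := ltnP n N.
    by move: (n) nN; near: d'; exact: near0_finite.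
  by move=> /(zN _ _ Nn d'0 (le_trans d'd de)).
- have [nN|] := ltnP n (maxn N N').
    by move: (n) nN; near: d'; exact: near0_finite.
  rewrite geq_max => /andP[Nn N'n] zy; exfalso.
  apply: (zN n e) => //; apply: (dP _ (y n)); first exact: fuzzy_ball_sub zy.
  apply: fuzzy_ball_sym => //; apply: fuzzy_ball_sub (xyn n) => //.
    exact: N'P.
  exact: N'P.
Unshelve. all: by end_near. Qed.

(** Otherwise let the ball of size [1 / (n + 1)] around [x_n] be contained in no
member of [G]. A member of [G] that contains [x_n] misses a point [y_n] of this
ball, and a member around a cluster point of [x_n] contains one of the balls. *)
Lemma closed_discrete_UD_Lebesgue : closed_discrete_UD -> fuzzy_Lebesgue X.
Proof.
move=> cdUD G Gop Gcov.
suff : \forall e \near 0^'+, forall x, exists2 U, G U & D x e `<=` U.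
  by move=> /near0_ex[e [e0 e1 eG]]; exists e, e; rewrite e0.
apply: contrapT => /not_near0 nG.
have Gx x : exists2 U, G U & U x.
  by have : (\bigcup_(U in G) U) x by rewrite Gcov.
have /choice[x xP] n : exists x, forall U, G U -> ~ D x n.+1%:R^-1 `<=` U.
  have [e [e0 en /existsNP[x xP]]] := nG n.
  exists x => U GU xU; apply: xP; exists U => //.
  by apply: subset_trans xU; exact: fuzzy_ball_sub.
have /choice[y yP] n : exists y, x n <> y /\ D (x n) n.+1%:R^-1 y.
  have [U GU Ux] := Gx (x n).
  have /existsNP[y /not_implyP[xy Uy]] := xP n U GU.
  by exists y; split => // xE; apply: Uy; rewrite -xE.
have [z zP] := close_pairs_cluster cdUD
  (fun n => proj1 (yP n)) (fun n => proj2 (yP n)).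
have [U GU Uz] := Gx z.
have /nbhs_fuzzyP : nbhs z U by apply: open_nbhs_nbhs; split => //; exact: Gop.
move=> /near0_ex[e [e0 _ zU]].
have [d [d0 _ dP]] := near0_ex (fuzzy_ball_trans e0).
have [N NP] := near0_invn (nbhs_right_ltW d0).
have [n Nn zx] := zP d d0 N.
apply: (xP n U GU); apply: subset_trans zU => w xw; apply: dP zx _.
by apply: fuzzy_ball_sub xw; rewrite ?invr_gt0//; exact: NP.
Qed.

(** Without a finite [e]-net, there is an [e]-separated sequence of accumulation
points [x_n]. Each [x_n] has other points arbitrarily close to it, so [x_n]
would have a cluster point. *)
Lemma limit_points_totally_bounded : closed_discrete_UD -> forall e, 0 < e ->
  exists s : seq X, forall x, limit_point [set: X] x ->
    exists2 a, a \in s & D a e x.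
Proof.
move=> cdUD e e0; apply: contrapT => /forallNP nnet.
have /choice[pick pickP] (s : seq X) : exists x, limit_point [set: X] x /\
    forall a, a \in s -> ~ D a e x.
  have /existsNP[x /not_implyP[X'x /forall2NP xP]] := nnet s.
  by exists x; split => // a sa; case: (xP a).
(* [xs n] lists the terms of index less than [n]. *)
pose xs n := iter n (fun s => pick s :: s) [::].
pose x n := pick (xs n).
have x_in m n : (m < n)%N -> x m \in xs n.
  elim: n => // n IHn; rewrite ltnS leq_eqVlt inE => /predU1P[->|/IHn ->].
    by rewrite eqxx.
  by rewrite orbT.
have x_sep m n : (m < n)%N -> ~ D (x m) e (x n).
  by move=> mn; have [_ ] := pickP (xs n); apply; exact: x_in.
have /choice[y yP] n : exists y, x n <> y /\ D (x n) n.+1%:R^-1 y.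
  have [X'x _] := pickP (xs n).
  have n0 : (0 : R) < n.+1%:R^-1 by rewrite invr_gt0.
  have [y [/eqP yx _ xy]] := X'x _ (nbhs_fuzzy_ball _ n0).
  by exists y; split => // /esym.
have [z zP] := close_pairs_cluster cdUD
  (fun n => proj1 (yP n)) (fun n => proj2 (yP n)).
have [d [d0 _ dP]] := near0_ex (fuzzy_ball_trans e0).
have [m _ zm] := zP d d0 0%N; have [n mn zn] := zP d d0 m.+1.
by apply: (x_sep _ _ mn); apply: dP zn; exact: fuzzy_ball_sym.
Qed.

(** If a filter [F] on [X'] has no cluster point, then the open sets that miss a
member of [F] form a cover of [X]. By the Lebesgue property, all balls of some
size [e] miss a member of [F]; but finitely many of them cover [X']. *)
Lemma closed_discrete_UD_compact : closed_discrete_UD ->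
  compact (limit_point [set: X]).
Proof.
move=> cdUD F FF FX'; apply: contrapT => /set0P/negP/negPn/eqP nclF.
pose G := [set U : set X | open U /\ exists2 W, F W & U `&` W = set0].
have GT : \bigcup_(U in G) U = setT.
  apply/seteqP; split => // z _.
  suff [U [W [zU FW UW]]] : exists U W, [/\ nbhs z U, F W & U `&` W = set0].
    exists U°; last exact: zU.
    split; first exact: open_interior.
    exists W => //; apply/seteqP; split => // w [/interior_subset Uw Ww].
    by rewrite -UW.
  have [X'z|] := pselect (limit_point [set: X] z).
    have : ~ cluster F z.
      move=> cz.
      by have : (limit_point [set: X] `&` cluster F) z by []; rewrite nclF.
    rewrite /cluster/= => /existsNP[W /existsNP[U /not_implyP[FW]]].
    move=> /not_implyP[zU] /set0P/negP/negPn/eqP WU; exists U, W; split => //.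
    by rewrite setIC.
  (* A point [z] outside [X'] is isolated, hence some neighbourhood of [z]
     misses [X']. *)
  move=> nX'z; exists (~` limit_point [set: X]), (limit_point [set: X]).
  split; rewrite ?setICl//.
  move: nX'z; rewrite not_limit_pointE => -[V zV]; rewrite setTI => Vz.
  apply: filterS (nbhs_interior zV) => w wV X'w.
  have [y [/eqP yw _ Vy]] := X'w _ wV.
  by apply: yw; rewrite (Vz y Vy) (Vz w (nbhs_singleton wV)).
have [r [t [/andP[r0 _] t0 rtG]]] := closed_discrete_UD_Lebesgue cdUD
  (fun U GU => proj1 GU) GT.
have [e [e0 eG]] : exists e, 0 < e /\
    forall x, exists2 W, F W & D x e `&` W = set0.
  have [e [e0 _ sub]] := near0_ex (near0_fuzzy_ball_sub r0 t0).
  exists e; split => // x.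
  have [U [_ [W FW UW]] xU] := rtG x; exists W => //.
  by apply/seteqP; split => // w [/sub/xU Uw Ww]; rewrite -UW.
have /choice[W WP] x : exists W, F W /\ D x e `&` W = set0.
  by have [W FW xW] := eG x; exists W.
have [s sP] := limit_points_totally_bounded cdUD e0.
have : \forall w \near F, forall i : 'I_(size s), W (tnth (in_tuple s) i) w.
  by apply: filter_forall => i; have [] := WP (tnth (in_tuple s) i).
move=> /(filterI FX')/filter_ex[w [/sP[a sa aw] sW]].
have Ww : W a w by have /tnthP[i ->] : a \in in_tuple s.
have [_ aW] := WP a.
by have : (D a e `&` W a) w by []; rewrite aW.
Qed.

(** * The implications between the conditions *)

(** The preimages of the intervals of length [e] cover the space, and two points
of the same preimage have images at distance less than [e]. *)
Lemma Lebesgue_R_uniformly_continuous (f : X -> R) :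
  fuzzy_Lebesgue X -> continuous f -> R_uniformly_continuous f.
Proof.
move=> LX cf e e0; have e20 : 0 < e / 2 by rewrite divr_gt0.
pose G := [set U : set X | exists c, U = f @^-1` ball c (e / 2)].
have Gop : G `<=` open.
  move=> _ [c ->]; apply: open_comp; last exact: ball_open.
  by move=> x _; exact: cf.
have Gcov : \bigcup_(U in G) U = setT.
  apply/seteqP; split => // x _.
  by exists (f @^-1` ball (f x) (e / 2)); [exists (f x)|exact: ballxx].
have [r [t [r01 t0 rtG]]] := LX G Gop Gcov.
exists r, t; split => // x y xy; have [U [c ->] xU] := rtG x.
have fx := xU x (fuzzy_ball_center x (proj1 (andP r01)) t0).
by apply: (@ball_splitr _ _ c); [exact: fx|exact: xU].
Qed.

(** From closer and closer pairs of distinct points, a sequence of pairs is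
extracted so that first points never equal second points. A Urysohn function
for the two sets jumps by 1 between the points of each pair. *)
Lemma bounded_R_uniformly_continuous_UD :
  (forall f : X -> R, continuous f -> bounded_fun f ->
    R_uniformly_continuous f) -> closed_discrete_UD.
Proof.
move=> ucX A A0; apply: contrapT => /fuzzy_uniformly_discreteP/not_near0 nUD.
have /choice[x /choice[y xyP]] (n : nat) : exists x y,
    [/\ A x, A y, D x n.+1%:R^-1 y & x <> y].
  have [e [e0 en]] := nUD n.
  move=> /existsNP[x /existsNP[y]] /not_implyP[Ax] /not_implyP[Ay].
  move=> /not_implyP[xy nxy]; exists x, y; split => //.
  exact: fuzzy_ball_sub xy.
have /choice[N NP] w : exists N : nat, forall n : nat, (N <= n)%N ->
    forall v, A v -> D w n.+1%:R^-1 v -> v = w.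
  apply: (@near0_invn (fun e => forall v, A v -> D w e v -> v = w)).
  apply/near0_limit_pointN.
  by move/limit_point_eq0P : A0; apply.
(* From the index [N w] on, the ball of size [1 / (n + 1)] around [w] has no
   other point of [A]; so [N] exceeds [n] at both points of the [n]-th pair. *)
have xN n : (n < N (x n))%N.
  rewrite ltnNge; apply/negP => Nn; have [Ax Ay xy nxy] := xyP n.
  by apply: nxy; rewrite (NP _ _ Nn _ Ay xy).
have yN n : (n < N (y n))%N.
  rewrite ltnNge; apply/negP => Nn; have [Ax Ay xy nxy] := xyP n.
  apply: nxy; apply: (NP _ _ Nn _ Ax); apply: fuzzy_ball_sym xy.
  by rewrite invr_gt0.
(* With this choice of indices, the values of [N] at the points of a pair are at
   most the next index, hence less than the values of [N] at all later pairs: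
   pairs of different ranks have no point in common. *)
pose k := fix k j :=
  if j is j'.+1 then maxn (N (x (k j'))) (N (y (k j'))) else 0%N.
have kS j : (k j < k j.+1)%N by rewrite /= leq_max xN.
have k_le i j : (i <= j)%N -> (k i <= k j)%N.
  apply: (homo_leq (f := k) (r := leq)) => // [n m p|n]; first exact: leq_trans.
  exact: ltnW.
have k_ge j : (j <= k j)%N.
  by elim: j => // j /leq_ltn_trans; apply; exact: kS.
pose B := range (x \o k); pose C := range (y \o k).
have BC0 : B `&` C = set0.
  apply/seteqP; split => // _ [[i _ <-] [j _ /= yx]].
  have [ij|ji|ij] := ltngtP i j.
  - have := yN (k j); rewrite ltnNge => /negP; apply; rewrite yx.
    by apply: leq_trans (k_le _ _ ij); rewrite /= leq_max leqnn.
  - have := xN (k i); rewrite ltnNge => /negP; apply; rewrite -yx.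
    by apply: leq_trans (k_le _ _ ji); rewrite /= leq_max leqnn orbT.
  - by have [_ _ _] := xyP (k j); apply; rewrite yx ij.
have clB : closed B.
  apply: limit_point_eq0_closed; apply: limit_point_eq0S A0.
  by move=> _ [j _ <-]; have [] := xyP (k j).
have clC : closed C.
  apply: limit_point_eq0_closed; apply: limit_point_eq0S A0.
  by move=> _ [j _ <-]; have [] := xyP (k j).
have /(@uniform_separatorP _ R)[f [cf f01 fB fC]] :=
  normal_uniform_separator fuzzy_normal clB clC BC0.
have bf : bounded_fun f.
  exists 1; split => // c c1 z _ /=.
  have : `[0, 1]%classic (f z) by apply: f01; exists z.
  rewrite /= in_itv/= => /andP[fz0 fz1]; rewrite ger0_norm//.
  exact: le_trans fz1 (ltW c1).
have [r [s [/andP[r0 r1] s0 ucf]]] := ucX f cf bf 1 ltr01.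
have [n nP] := near0_invn (near0_fuzzy_ball_sub r0 s0).
have [_ _ xyn _] := xyP (k n).
have := ucf _ _ (nP _ (k_ge n) _ _ xyn).
have -> : f (x (k n)) = 0 by apply: fB; exists (x (k n)) => //; exists n.
have -> : f (y (k n)) = 1 by apply: fC; exists (y (k n)) => //; exists n.
by rewrite sub0r normrN normr1 ltxx.
Qed.

(** A limit point of the complement is an accumulation point of the space, and
so has a ball disjoint from the complement. *)
Lemma closed_discrete_UD_setC_ball : closed_discrete_UD ->
  forall r s, 0 < r < 1 -> 0 < s ->
  fuzzy_uniformly_discrete (~` fuzzy_ball_set (limit_point [set: X]) r s).
Proof.
move=> cdUD r s r01 s0; apply: cdUD; apply/limit_point_eq0P => z zl.
have r0 := proj1 (andP r01).
have X'z : limit_point [set: X] z.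
  by move=> U /zl[y [yz _ Uy]]; exists y.
have [e [e0 _ eP]] := near0_ex (near0_fuzzy_ball_sub r0 s0).
have [y [_ yB zy]] := zl _ (nbhs_fuzzy_ball z e0).
by apply: yB; exists z => //; exact: eP.
Qed.

(** The bound [0 <= c] accounts for empty sets, whose supremum is 0. *)
Lemma fuzzy_dist_set_leP x A t (c : R) : 0 < t -> 0 <= c ->
  fuzzy_dist_set x A t <= c <-> forall a, A a -> M x a t <= c.
Proof.
move=> t0 c0; split=> [supc a Aa|xA].
  apply: le_trans supc; apply: ub_le_sup; last by exists a.
  exists 1 => _ [b _ <-].
  by have := fuzzy_dist_itv x b t0; rewrite in_itv/= => /andP[].
have [->|/set0P[a Aa]] := eqVneq A set0.
  by rewrite /fuzzy_dist_set image_set0 sup0.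
apply: ge_sup; first by exists (M x a t), a.
by move=> _ [b Ab <-]; exact: xA.
Qed.

(** Let two steps of size [d] stay within radius [d1] and time [t1]. A point
[d]-close to [x] cannot be [d]-close to [S], since [x] would then be too
close to [S]; so both points lie in the uniformly discrete complement of the
neighbourhood of size [d]. *)
Lemma UD_setC_ball_isolation (S : set X) :
  (forall r s, 0 < r < 1 -> 0 < s ->
    fuzzy_uniformly_discrete (~` fuzzy_ball_set S r s)) ->
  forall d1 t1, 0 < d1 < 1 -> 0 < t1 -> exists d2 t2,
    [/\ 0 < d2 < 1, 0 < t2 & forall x, fuzzy_dist_set x S t1 <= 1 - d1 ->
      fuzzy_dist_set x [set y | y <> x] t2 <= 1 - d2].
Proof.
move=> UD d1 t1 /andP[d10 d11] t10.
have [e [e0 _ eP]] := near0_ex (near0_fuzzy_ball_sub d10 t10).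
have [d [d0 d1' dP]] := near0_ex (fuzzy_ball_trans e0).
have d01 : 0 < d < 1 by rewrite d0.
have /fuzzy_uniformly_discreteP UDd := UD d d d01 d0.
have [c [c0 c1 [cd cUD]]] :=
  near0_ex (filterI (near0_fuzzy_ball_sub d0 d0) UDd).
exists c, c; rewrite c0 c1; split => // x.
have d1c : 0 <= 1 - d1 by rewrite subr_ge0 ltW.
move=> /(fuzzy_dist_set_leP _ _ t10 d1c) xS.
apply/fuzzy_dist_set_leP => //; first by rewrite subr_ge0 ltW.
move=> y yx; rewrite leNgt; apply/negP => xy.
have xNball a : S a -> ~ D a e x.
  move=> Sa ax; have := xS a Sa; apply/negP; rewrite -ltNge.
  by apply: eP; exact: fuzzy_ball_sym.
apply: yx; apply/esym/cUD => //.
- move=> [a Sa ax]; apply: (xNball a Sa); apply: dP ax _.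
  exact: fuzzy_ball_center.
- move=> [a Sa ay]; apply: (xNball a Sa); apply: dP ay _.
  by apply: fuzzy_ball_sym => //; exact: cd.
Qed.

(** Compactness gives a size [e] such that the [e]-balls around [S] refine the
cover. A point [d]-close to [S] has its [d]-ball inside such a ball, and any
other point is the only point of its ball of radius [d2] and time [t2]. *)
Lemma compact_isolation_Lebesgue (S : set X) : compact S ->
  (forall d1 t1, 0 < d1 < 1 -> 0 < t1 -> exists d2 t2,
    [/\ 0 < d2 < 1, 0 < t2 & forall x, fuzzy_dist_set x S t1 <= 1 - d1 ->
      fuzzy_dist_set x [set y | y <> x] t2 <= 1 - d2]) ->
  fuzzy_Lebesgue X.
Proof.
move=> cS iso G Gop Gcov.
have Gx x : exists2 U, G U & U x.
  by have : (\bigcup_(U in G) U) x by rewrite Gcov.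
suff : \forall e \near 0^'+, forall x, exists2 U, G U & D x e `<=` U.
  by move=> /near0_ex[e [e0 e1 eG]]; exists e, e; rewrite e0.
have Leb : \forall e \near 0^'+, S `<=` [set x | exists2 U, G U & D x e `<=` U].
  have /compact_near_coveringP := cS.
  apply => x Sx; have [U GU Ux] := Gx x.
  have /nbhs_fuzzyP/near0_ex[e [e0 _ eU]] : nbhs x U.
    by apply: open_nbhs_nbhs; split => //; exact: Gop.
  have [d [d0 _ dP]] := near0_ex (fuzzy_ball_trans e0).
  exists (D x d, [set d' | forall x, D x d' `<=` D x d]).
    by split; [exact: nbhs_fuzzy_ball|exact: near0_fuzzy_ball_sub].
  move=> [x' d'] [/= xx' d'd]; exists U => //.
  by move=> y x'y; apply: eU; apply: dP xx' _; exact: d'd.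
have [e [e0 _ eP]] := near0_ex Leb.
have [d [d0 d1 dP]] := near0_ex (fuzzy_ball_trans e0).
have d01 : 0 < d < 1 by rewrite d0.
have [d2 [t2 [/andP[d20 d21] t20 isod]]] := iso d d d01 d0.
near=> c => x.
have cd y : D y c `<=` D y d by move: y; near: c; exact: near0_fuzzy_ball_sub.
have cd2 y : D y c `<=` fuzzy_ball y d2 t2.
  by move: y; near: c; exact: near0_fuzzy_ball_sub.
have [[a Sa xa]|/forall2NP nS] := pselect (exists2 a, S a & D x d a).
  have [U GU aU] := eP a Sa; exists U => // y xy; apply: aU.
  by apply: (dP _ x); [exact: fuzzy_ball_sym|exact: cd].
have [U GU Ux] := Gx x; exists U => // y /cd2 xy.
suff -> : y = x by [].
apply: contrapT => yx.
have : fuzzy_dist_set x S d <= 1 - d.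
  apply/fuzzy_dist_set_leP => //; first by rewrite subr_ge0 ltW.
  by move=> a Sa; rewrite leNgt; apply/negP; case: (nS a).
move=> /isod/(fuzzy_dist_set_leP _ _ t20) xle.
have := xle _ y yx; rewrite subr_ge0 (ltW d21) leNgt => /(_ isT)/negP; exact.
Unshelve. all: by end_near. Qed.

End FuzzyEntourages.

Theorem theorem3p1 (R : realType) (X : fuzzyMetricSpace R) :
  let X' : set X := limit_point [set: X] in
  [<-> (* (a) *) fuzzy_Lebesgue X ;
       (* (b) *) forall f : X -> R, continuous f -> R_uniformly_continuous f ;
       (* (c) *) forall f : X -> R, continuous f -> bounded_fun f ->
         R_uniformly_continuous f ;
       (* (d) *) forall A : set X, closed A -> discrete_subset A ->
         fuzzy_uniformly_discrete A ;
       (* (e) *) compact X' /\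
         (forall r s : R, 0 < r < 1 -> 0 < s ->
           fuzzy_uniformly_discrete (~` fuzzy_ball_set X' r s)) ;
       (* (f) *) compact X' /\
         (forall d1 t1 : R, 0 < d1 < 1 -> 0 < t1 ->
           exists d2 t2 : R, [/\ 0 < d2 < 1, 0 < t2 &
             forall x : X, fuzzy_dist_set x X' t1 <= 1 - d1 ->
               fuzzy_dist_set x [set y | y <> x] t2 <= 1 - d2])].
Proof.
move=> X'; tfae.
- by move=> LX f cf; exact: Lebesgue_R_uniformly_continuous.
- by move=> uc f cf _; exact: uc.
- move=> /bounded_R_uniformly_continuous_UD cdUD A clA dA.
  by apply: cdUD; apply/closed_discrete_limit_pointP.
- move=> UD; have cdUD : @closed_discrete_UD R X.
    by move=> A /closed_discrete_limit_pointP[clA dA]; exact: UD.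
  split; first exact: closed_discrete_UD_compact.
  exact: closed_discrete_UD_setC_ball.
- by move=> [cX' UD]; split => //; exact: UD_setC_ball_isolation.
- by move=> [cX' iso]; exact: compact_isolation_Lebesgue cX' iso.
Qed.
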